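(* Let $\mathcal{A}$ and $\mathcal{S}$ be Sudoku grids. If $\theta$ is an automorphism of $\mathcal{A}$ and $\mathcal{S}$ is the unique solution of $\mathcal{A}$, then $\theta$ is an automorphism of $\mathcal{S}$.
   Context: A grid is a $9\times 9$ matrix $\mathcal{A}=[A_{ij}]_{9\times 9}$ of nonempty subsets $A_{ij}\subseteq\{1,\dots,9\}$; it is full if $|A_{ij}|=1$ for all $i,j$. A Sudoku grid is a grid such that whenever $A_{ij}=\{d\}$, the digit $d$ belongs to no $A_{\ell m}$ for any other cell $(\ell,m)\ne(i,j)$ in the same row, column or (standard $3\times 3$) box. A solution of a Sudoku grid $\mathcal{A}=[A_{ij}]$ is a full Sudoku grid $\mathcal{S}=[S_{ij}]$ with $S_{ij}\subseteq A_{ij}$ for all $i,j$. Elementary Sudoku transformations are the following maps from Sudoku grids to Sudoku grids. Geometric transformations: the identity $\mathrm{id}$; $\delta$, where $\delta(\mathcal{A})_{ij}=A_{ji}$; $\chi$, where $\chi(\mathcal{A})_{ij}=A_{10-i,j}$; $\overline\chi=\delta\circ\chi\circ\delta$; $\overline\delta=\overline\chi\circ\delta\circ\overline\chi$; $\rho_1=\delta\circ\chi$; $\rho_2=\rho_1\circ\rho_1$; $\rho_3=\rho_1\circ\rho_1\circ\rho_1$. Shuffles: for a bijection $f$ of $\{1,\dots,9\}$ respecting the partition $\{\{1,2,3\},\{4,5,6\},\{7,8,9\}\}$ (i.e. $i,j$ lie in the same block iff $f(i),f(j)$ do), the row shuffle $\sigma_f(\mathcal{A})_{ij}=A_{f(i)\,j}$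 and the column shuffle $\tau_f(\mathcal{A})_{ij}=A_{i\,f(j)}$. Relabellings: for any bijection $f$ of $\{1,\dots,9\}$, $\lambda_f(\mathcal{A})_{ij}=\{f(d):d\in A_{ij}\}$. A Sudoku transformation is any finite composition of elementary Sudoku transformations. A Sudoku transformation $\theta$ is an automorphism of a Sudoku grid $\mathcal{A}$ if $\theta(\mathcal{A})=\mathcal{A}$. *)

(* Defs.v *)
From HB Require Import structures.
From mathcomp Require Import all_boot all_algebra all_fingroup.

Set Implicit Arguments.
Unset Strict Implicit.
Unset Printing Implicit Defensive.

(* Digits and row/column indices 1, ..., 9 are represented by 0, ..., 8 in
   'I_9, so that the blocks {1,2,3}, {4,5,6}, {7,8,9} are the fibres of
   i |-> i %/ 3 and the reflection i |-> 10 - i is rev_ord. *)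
Definition block (i : 'I_9) : nat := i %/ 3.

Definition cell : Type := ('I_9 * 'I_9)%type.

Definition peers (c c' : cell) : bool :=
  (c' != c) &&
  [|| c'.1 == c.1,
      c'.2 == c.2
    | (block c'.1 == block c.1) && (block c'.2 == block c.2)].

Definition is_grid (A : 'M[{set 'I_9}]_9) : bool :=
  [forall i, forall j, A i j != set0].

Definition is_sudoku (A : 'M[{set 'I_9}]_9) : bool :=
  is_grid A &&
  [forall i, forall j, forall d, (A i j == [set d]) ==>
    [forall l, forall m, peers (i, j) (l, m) ==> (d \notin A l m)]].

Record sudoku_grid := SudokuGrid {
  entries :> 'M[{set 'I_9}]_9;
  entriesP : is_sudoku entries
}.
HB.instance Definition _ := [isSub for entries].
HB.instance Definition _ := [Equality of sudoku_grid by <:].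

Definition full (A : 'M[{set 'I_9}]_9) : Prop := forall i j, #|A i j| = 1.

Definition solution (A S : sudoku_grid) : Prop :=
  full S /\ forall i j, S i j \subset A i j.

Lemma is_sudokuP (A : 'M[{set 'I_9}]_9) :
  reflect ((forall i j, A i j != set0) /\
           (forall i j d, A i j = [set d] ->
              forall l m, peers (i, j) (l, m) -> d \notin A l m))
          (is_sudoku A).
Proof.
apply: (iffP andP) => -[gA sA]; split.
- by move=> i j; move/forallP: gA => /(_ i) /forallP /(_ j).
- move=> i j d Ad l m plm.
  move/forallP: sA => /(_ i) /forallP /(_ j) /forallP /(_ d).
  rewrite Ad eqxx /= => /forallP /(_ l) /forallP /(_ m).
  by rewrite plm.
- by apply/forallP => i; apply/forallP => j; apply: gA.
- apply/forallP => i; apply/forallP => j; apply/forallP => d.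
  apply/implyP => /eqP Ad; apply/forallP => l; apply/forallP => m.
  by apply/implyP; apply: sA.
Qed.

Lemma reindex_sudoku (p : 'I_9 -> 'I_9 -> cell) (A : sudoku_grid) :
  (forall i j l m, peers (p i j) (p l m) = peers (i, j) (l, m)) ->
  is_sudoku (\matrix_(i, j) A (p i j).1 (p i j).2).
Proof.
move=> pp; have /is_sudokuP[gA sA] := entriesP A.
apply/is_sudokuP; split=> [i j|i j d]; rewrite !mxE // => Ad l m plm.
rewrite mxE; apply: sA Ad _ _ _.
by rewrite -!surjective_pairing pp.
Qed.

Lemma delta_subproof (A : sudoku_grid) : is_sudoku (\matrix_(i, j) A j i).
Proof.
apply: (reindex_sudoku (p := fun i j => (j, i))) => i j l m.
rewrite /peers /= !xpair_eqE andbC [RHS]andbC orbCA.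
by rewrite [(l == i) && _]andbC [(block m == _) && _]andbC.
Qed.
Definition delta (A : sudoku_grid) : sudoku_grid :=
  SudokuGrid (delta_subproof A).

Definition respects_blocks (f : {perm 'I_9}) : bool :=
  [forall i, forall j, (block (f i) == block (f j)) == (block i == block j)].

Lemma block_rev (i j : 'I_9) :
  (block (rev_ord i) == block (rev_ord j)) = (block i == block j).
Proof.
have E k : block (rev_ord k) = 2 - block k.
  by case: k; do 9?[case=> //].
have L (k : 'I_9) : block k <= 2 by case: k; do 9?[case=> //].
rewrite !E; apply/eqP/eqP => [h|-> //].
by rewrite -(subKn (L i)) h subKn.
Qed.

Lemma chi_subproof (A : sudoku_grid) :
  is_sudoku (\matrix_(i, j) A (rev_ord i) j).
Proof.
apply: (reindex_sudoku (p := fun i j => (rev_ord i, j))) => i j l m.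
by rewrite /peers /= !xpair_eqE (inj_eq rev_ord_inj) block_rev.
Qed.
Definition chi (A : sudoku_grid) : sudoku_grid := SudokuGrid (chi_subproof A).

Definition chi_bar : sudoku_grid -> sudoku_grid := delta \o chi \o delta.
Definition delta_bar : sudoku_grid -> sudoku_grid :=
  chi_bar \o delta \o chi_bar.
Definition rho1 : sudoku_grid -> sudoku_grid := delta \o chi.
Definition rho2 : sudoku_grid -> sudoku_grid := rho1 \o rho1.
Definition rho3 : sudoku_grid -> sudoku_grid := rho1 \o rho1 \o rho1.

Lemma row_shuffle_subproof (f : {perm 'I_9}) (A : sudoku_grid) :
  respects_blocks f -> is_sudoku (\matrix_(i, j) A (f i) j).
Proof.
move=> fB; apply: (reindex_sudoku (p := fun i j => (f i, j))) => i j l m.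
move/forallP: fB => /(_ l) /forallP /(_ i) /eqP fB.
by rewrite /peers /= !xpair_eqE (inj_eq perm_inj) fB.
Qed.
Definition row_shuffle (f : {perm 'I_9}) (fB : respects_blocks f)
    (A : sudoku_grid) : sudoku_grid :=
  SudokuGrid (row_shuffle_subproof A fB).

Lemma col_shuffle_subproof (f : {perm 'I_9}) (A : sudoku_grid) :
  respects_blocks f -> is_sudoku (\matrix_(i, j) A i (f j)).
Proof.
move=> fB; apply: (reindex_sudoku (p := fun i j => (i, f j))) => i j l m.
move/forallP: fB => /(_ m) /forallP /(_ j) /eqP fB.
by rewrite /peers /= !xpair_eqE (inj_eq perm_inj) fB.
Qed.
Definition col_shuffle (f : {perm 'I_9}) (fB : respects_blocks f)
    (A : sudoku_grid) : sudoku_grid :=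
  SudokuGrid (col_shuffle_subproof A fB).

Lemma relabel_subproof (f : {perm 'I_9}) (A : sudoku_grid) :
  is_sudoku (\matrix_(i, j) [set f d | d in A i j]).
Proof.
have /is_sudokuP[gA sA] := entriesP A.
apply/is_sudokuP; split=> [i j|i j d]; rewrite !mxE; first by rewrite imset_eq0.
move=> Ad l m plm; rewrite mxE -(permKV f d) (mem_imset _ _ perm_inj).
apply: sA plm; apply: (imset_inj (@perm_inj _ f)).
by rewrite Ad imset_set1 permKV.
Qed.
Definition relabel (f : {perm 'I_9}) (A : sudoku_grid) : sudoku_grid :=
  SudokuGrid (relabel_subproof f A).

Inductive elementary : (sudoku_grid -> sudoku_grid) -> Prop :=
| elementary_id : elementary id
| elementary_delta : elementary delta
| elementary_chi : elementary chi
| elementary_chi_bar : elementary chi_bar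
| elementary_delta_bar : elementary delta_bar
| elementary_rho1 : elementary rho1
| elementary_rho2 : elementary rho2
| elementary_rho3 : elementary rho3
| elementary_row_shuffle f (fB : respects_blocks f) :
    elementary (row_shuffle fB)
| elementary_col_shuffle f (fB : respects_blocks f) :
    elementary (col_shuffle fB)
| elementary_relabel f : elementary (relabel f).

(* The last constructor makes the notion depend only on the values of the map,
   without appealing to functional extensionality. *)
Inductive sudoku_transformation : (sudoku_grid -> sudoku_grid) -> Prop :=
| transformation_elementary theta :
    elementary theta -> sudoku_transformation theta
| transformation_comp theta1 theta2 :
    sudoku_transformation theta1 -> sudoku_transformation theta2 ->
    sudoku_transformation (theta1 \o theta2)
| transformation_ext theta1 theta2 :
    theta1 =1 theta2 -> sudoku_transformation theta1 ->
    sudoku_transformation theta2.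

Definition automorphism (theta : sudoku_grid -> sudoku_grid)
    (A : sudoku_grid) : Prop :=
  sudoku_transformation theta /\ theta A = A.

(* Main.v *)
Require Import Defs.
From mathcomp Require Import all_boot.
From mathcomp Require Import matrix perm.

(** Every Sudoku transformation preserves the relation "S is a solution of A".
    Hence an automorphism of A maps solutions of A to solutions of A, so it fixes
    a unique one. *)

(** Being full and being contained in [A] are conditions on single cells. Moving cells by a common
    permutation, or applying one bijection to all entries, keeps both, and composition inherits
    this. So [theta S] solves [theta A = A], and uniqueness gives [theta S = S]. *)

Definition preserves_solutions (theta : sudoku_grid -> sudoku_grid) : Prop :=
  forall A S, solution A S -> solution (theta A) (theta S).

Lemma preserves_solutions_comp theta1 theta2 :
  preserves_solutions theta1 -> preserves_solutions theta2 ->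
  preserves_solutions (theta1 \o theta2).
Proof. by move=> p1 p2 A S AS; apply/p1/p2. Qed.

Lemma delta_preserves_solutions : preserves_solutions delta.
Proof. by move=> A S [fS sS]; split=> i j; rewrite !mxE. Qed.

Lemma chi_preserves_solutions : preserves_solutions chi.
Proof. by move=> A S [fS sS]; split=> i j; rewrite !mxE. Qed.

Lemma row_shuffle_preserves_solutions f (fB : respects_blocks f) :
  preserves_solutions (row_shuffle fB).
Proof. by move=> A S [fS sS]; split=> i j; rewrite !mxE. Qed.

Lemma col_shuffle_preserves_solutions f (fB : respects_blocks f) :
  preserves_solutions (col_shuffle fB).
Proof. by move=> A S [fS sS]; split=> i j; rewrite !mxE. Qed.

(** Here the entries themselves change: images respect inclusion, and injectivity of [f] keeps
    singletons singletons. *)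
Lemma relabel_preserves_solutions f : preserves_solutions (relabel f).
Proof.
move=> A S [fS sS]; split=> i j; rewrite !mxE; last exact: imsetS.
by rewrite card_imset //; apply: perm_inj.
Qed.

Lemma elementary_preserves_solutions theta :
  elementary theta -> preserves_solutions theta.
Proof.
have pd := delta_preserves_solutions.
have px := chi_preserves_solutions.
have pc := preserves_solutions_comp.
have p1 : preserves_solutions rho1 := pc _ _ pd px.
have p2 : preserves_solutions rho2 := pc _ _ p1 p1.
have pxb : preserves_solutions chi_bar := pc _ _ (pc _ _ pd px) pd.
(* The cases left are [delta_bar], [rho3], the two shuffles and relabelling. *)
case=> // [||f fB|f fB|f].
- exact: (pc _ _ (pc _ _ pxb pd) pxb).
- exact: (pc _ _ p2 p1).
- exact: row_shuffle_preserves_solutions.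
- exact: col_shuffle_preserves_solutions.
- exact: relabel_preserves_solutions.
Qed.

Lemma transformation_preserves_solutions theta :
  sudoku_transformation theta -> preserves_solutions theta.
Proof.
elim=> [t|t1 t2 _ p1 _ p2|t1 t2 t12 _ p1 A S AS].
- exact: elementary_preserves_solutions.
- exact: preserves_solutions_comp.
- by rewrite -!t12; apply: p1.
Qed.

Theorem theorem8p2 (A S : sudoku_grid) (theta : sudoku_grid -> sudoku_grid)
    (theta_aut : automorphism theta A) (S_unique : unique (solution A) S) :
  automorphism theta S.
Proof.
have [theta_tr thetaA] := theta_aut; have [solS S_uniq] := S_unique.
(* Only the puzzle [A] is rewritten as [theta A], so that [theta] acts on both sides. *)
split=> //; apply/esym/S_uniq; rewrite -{1}thetaA.
exact: transformation_preserves_solutions.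
Qed.
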